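(* Let $g_n$ ($n\ge1$) be the total number of rows in all Kleene truth tables for bracketed implication with $n$ distinct variables $p_1,\dots,p_n$. Then $g_1=3$ and, for all $n\ge2$, $$g_n=\sum_{i=1}^{n-1}g_i\,g_{n-i}.$$
   Context: Truth values are $1$ (true), $0$ (false), $2$ (unknown). A bracketed formula with $n$ distinct variables connected by implication is a formula obtained from $p_1\Rightarrow p_2\Rightarrow\cdots\Rightarrow p_n$ by a complete bracketing (equivalently, a full binary tree with $n$ leaves labelled $p_1,\dots,p_n$ from left to right); for $n=1$ the only one is $p_1$. A row of the (three-valued, Kleene) truth table of such a formula is an assignment of $\{0,1,2\}$-values to $p_1,\dots,p_n$. Counting rows in all truth tables means counting pairs (bracketed formula, assignment). *)

(* Defs.v *)
From HB Require Import structures.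
From mathcomp Require Import all_boot.

Set Implicit Arguments.
Unset Strict Implicit.
Unset Printing Implicit Defensive.

(* Truth values are coded 0 (false), 1 (true), 2 (unknown). *)
Notation truth_value := 'I_3.

Inductive formula (X : Type) : Type :=
| Var of X
| Imp of formula X & formula X.

Arguments Var {X}.
Arguments Imp {X}.

Section FormulaCountable.

Variable X : Type.

Fixpoint tree_of_formula (f : formula X) : GenTree.tree X :=
  match f with
  | Var x => GenTree.Leaf x
  | Imp f1 f2 => GenTree.Node 0 [:: tree_of_formula f1; tree_of_formula f2]
  end.

Fixpoint formula_of_tree (t : GenTree.tree X) : option (formula X) :=
  match t with
  | GenTree.Leaf x => Some (Var x)
  | GenTree.Node _ [:: t1; t2] =>
      if (formula_of_tree t1, formula_of_tree t2) is (Some f1, Some f2)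
      then Some (Imp f1 f2) else None
  | _ => None
  end.

Lemma tree_of_formulaK : pcancel tree_of_formula formula_of_tree.
Proof. by elim=> //= f1 -> f2 ->. Qed.

End FormulaCountable.

HB.instance Definition _ (X : eqType) :=
  Equality.copy (formula X) (pcan_type (@tree_of_formulaK X)).
HB.instance Definition _ (X : choiceType) :=
  Choice.copy (formula X) (pcan_type (@tree_of_formulaK X)).
HB.instance Definition _ (X : countType) :=
  Countable.copy (formula X) (pcan_type (@tree_of_formulaK X)).

Fixpoint leaves (X : Type) (f : formula X) : seq X :=
  match f with
  | Var x => [:: x]
  | Imp f1 f2 => leaves f1 ++ leaves f2
  end.

(* The variable p_(i+1) is represented by the ordinal i, and [enum 'I_n] is the
   increasing list 0, ..., n-1; a complete bracketing of p_1 => ... => p_n is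
   thus a formula whose variables read from left to right are [enum 'I_n]. *)
Record bracketing (n : nat) := Bracketing {
  bracketing_formula :> formula 'I_n;
  _ : leaves bracketing_formula == enum 'I_n
}.

HB.instance Definition _ (n : nat) := [isSub for @bracketing_formula n].
HB.instance Definition _ (n : nat) := [Countable of bracketing n by <:].

Section BracketingFinite.

Variable n : nat.

(* All the formulas of height less than k. *)
Fixpoint bounded_formulas (k : nat) : seq (formula 'I_n) :=
  if k is k'.+1 then
    [seq Var i | i <- enum 'I_n] ++
    [seq Imp f1 f2 | f1 <- bounded_formulas k', f2 <- bounded_formulas k']
  else [::].

Lemma size_leaves_gt0 (f : formula 'I_n) : 0 < size (leaves f).
Proof. by elim: f => //= f1 IH1 f2 _; rewrite size_cat ltn_addr. Qed.

Lemma mem_bounded_formulas k (f : formula 'I_n) :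
  size (leaves f) <= k -> f \in bounded_formulas k.
Proof.
elim: k f => [|k IHk] f; first by rewrite leqNgt size_leaves_gt0.
case: f => [i|f1 f2] /= le_k; rewrite mem_cat; apply/orP.
  by left; apply: map_f; rewrite mem_enum.
right; move: le_k; rewrite size_cat => le_k.
apply: (allpairs_f Imp); apply: IHk; rewrite -ltnS; apply: leq_trans le_k.
  by rewrite -addn1 leq_add2l size_leaves_gt0.
by rewrite -add1n leq_add2r size_leaves_gt0.
Qed.

Definition bracketing_enum : seq (bracketing n) :=
  undup (pmap insub (bounded_formulas n)).

Lemma bracketing_enumP : Finite.axiom bracketing_enum.
Proof.
apply: Finite.uniq_enumP; first exact: undup_uniq.
move=> f; rewrite mem_undup mem_pmap_sub /=; apply: mem_bounded_formulas.
by case: f => f /= /eqP->; rewrite size_enum_ord.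
Qed.

HB.instance Definition _ := isFinite.Build (bracketing n) bracketing_enumP.

End BracketingFinite.

Notation assignment n := {ffun 'I_n -> truth_value}.

(* A row of the truth table of f is identified with its assignment (the value
   of f there is determined by it), so a row of some truth table is a pair. *)
Definition g (n : nat) : nat := #|{: bracketing n * assignment n}|.

(* Main.v *)
Require Import Defs.
From mathcomp Require Import all_boot.

Set Implicit Arguments.
Unset Strict Implicit.
Unset Printing Implicit Defensive.

(** A bracketing of a list of at least two variables is an implication between
a bracketing of a proper nonempty prefix and one of the remaining suffix, and
the number of bracketings of a list depends only on its length. Hence the
numbers [b n] of bracketings satisfy the Catalan recurrence, and
[g n = b n * 3 ^ n] inherits it because [3 ^ n = 3 ^ i * 3 ^ (n - i)]. *)

(* [k] is fuel: the enumeration is complete as soon as [size s <= k]. *)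
Fixpoint formulas_with_leaves (X : Type) (k : nat) (s : seq X) :
    seq (formula X) :=
  if k is k'.+1 then
    if s is [:: x] then [:: Var x] else
    [seq Imp f.1 f.2 | i <- index_iota 1 (size s),
       f <- [seq (f1, f2) | f1 <- formulas_with_leaves k' (take i s),
                            f2 <- formulas_with_leaves k' (drop i s)]]
  else [::].

(** Only a singleton takes the variable branch; the empty list falls under the general one, where
    [index_iota 1 0] is empty. *)
Lemma formulas_with_leavesS (X : Type) (k : nat) (s : seq X) :
  size s != 1 ->
  formulas_with_leaves k.+1 s =
    [seq Imp f.1 f.2 | i <- index_iota 1 (size s),
       f <- [seq (f1, f2) | f1 <- formulas_with_leaves k (take i s),
                            f2 <- formulas_with_leaves k (drop i s)]].
Proof. by case: s => [|x [|y s]]. Qed.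

Lemma size_formulas_with_leavesS (X : Type) (k : nat) (s : seq X) :
  size s != 1 ->
  size (formulas_with_leaves k.+1 s) =
  \sum_(1 <= i < size s) size (formulas_with_leaves k (take i s)) *
                         size (formulas_with_leaves k (drop i s)).
Proof.
move=> s_neq1; rewrite formulas_with_leavesS // size_allpairs_dep sumnE big_map.
by apply: eq_bigr => i _; rewrite size_allpairs.
Qed.

(** Labels never affect the count. This matters because a prefix or suffix of [enum 'I_n] is not
    itself of the form [enum 'I_i]. *)
Lemma eq_size_formulas_with_leaves (X Y : Type) (k : nat)
    (s : seq X) (t : seq Y) :
  size s = size t ->
  size (formulas_with_leaves k s) = size (formulas_with_leaves k t).
Proof.
elim: k s t => [|k IHk] s t eq_st //.
have [s1|s_neq1] := eqVneq (size s) 1.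
  by move: eq_st s1; case: s => [|x [|? ?]] //; case: t => [|y [|? ?]].
rewrite !size_formulas_with_leavesS -?eq_st //.
apply: eq_bigr => i _; congr (_ * _); apply: IHk.
  by rewrite !size_take eq_st.
by rewrite !size_drop eq_st.
Qed.

Lemma leaves_formulas_with_leaves (X : eqType) (k : nat) (s : seq X)
    (f : formula X) :
  f \in formulas_with_leaves k s -> leaves f = s.
Proof.
elim: k s f => [|k IHk] s f //=.
case: s => [|x [|y s]] //; first by rewrite inE => /eqP->.
case/allpairsPdep => i [p [_ /allpairsP[[f1 f2] /= [f1P f2P ->]] ->]] /=.
by rewrite (IHk _ _ f1P) (IHk _ _ f2P) cat_take_drop.
Qed.

Lemma size_leaves_formula_gt0 (X : Type) (f : formula X) :
  0 < size (leaves f).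
Proof. by elim: f => //= f1 IH1 f2 _; rewrite size_cat ltn_addr. Qed.

(** Each side of an implication has at least one leaf, so the other side has fewer leaves than the
    whole and one unit less of fuel suffices. *)
Lemma mem_formulas_with_leaves (X : eqType) (k : nat) (f : formula X) :
  size (leaves f) <= k -> f \in formulas_with_leaves k (leaves f).
Proof.
elim: k f => [|k IHk] f; first by rewrite leqNgt size_leaves_formula_gt0.
case: f => [x|f1 f2]; first by rewrite /= inE.
have f1_gt0 := size_leaves_formula_gt0 f1.
have f2_gt0 := size_leaves_formula_gt0 f2.
rewrite [leaves _]/= size_cat => le_k.
rewrite formulas_with_leavesS; last first.
  by rewrite size_cat gtn_eqF // -addn1 leq_add.
apply/allpairsPdep; exists (size (leaves f1)), (f1, f2).
split=> //.
  by rewrite mem_index_iota f1_gt0 size_cat -addn1 leq_add2l.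
rewrite take_size_cat // drop_size_cat //; apply: allpairs_f; apply: IHk.
  by rewrite -ltnS; apply: leq_trans le_k; rewrite -addn1 leq_add2l.
by rewrite -ltnS; apply: leq_trans le_k; rewrite -add1n leq_add2r.
Qed.

Lemma uniq_formulas_with_leaves (X : eqType) (k : nat) (s : seq X) :
  uniq (formulas_with_leaves k s).
Proof.
elim: k s => [|k IHk] s //=.
case: s => [|x [|y s]] //; set s' := [:: x, y & s].
apply: allpairs_uniq_dep; first exact: iota_uniq.
  by move=> i _; apply: allpairs_uniq => // -[? ?] [? ?].
(* The splitting position [i] is the number of leaves of the left subformula. *)
move=> u v /allpairsPdep[i [p [iP pP ->]]] /allpairsPdep[j [q [jP qP ->]]] /=.
case/allpairsP: pP => -[f1 f2] /= [f1P _ ->].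
case/allpairsP: qP => -[h1 h2] /= [h1P _ ->] [eq1 ->].
have size_left r f : r \in index_iota 1 (size s') ->
    f \in formulas_with_leaves k (take r s') -> size (leaves f) = r.
  rewrite mem_index_iota => /andP[_ r_lt] /leaves_formulas_with_leaves ->.
  exact: size_takel (ltnW r_lt).
by rewrite -(size_left _ _ iP f1P) -(size_left _ _ jP h1P) eq1.
Qed.

Lemma card_bracketing (X : Type) (n k : nat) (s : seq X) :
  size s = n -> n <= k ->
  #|{: bracketing n}| = size (formulas_with_leaves k s).
Proof.
move=> size_s le_k; have s_enum : size s = size (enum 'I_n).
  by rewrite size_enum_ord.
rewrite (eq_size_formulas_with_leaves k s_enum) cardT.
(* Both lists of formulas are duplicate-free, so it suffices that they have the same members. *)
rewrite -(size_map val); apply/perm_size/uniq_perm.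
- by rewrite (map_inj_uniq val_inj) enum_uniq.
- exact: uniq_formulas_with_leaves.
move=> f; apply/mapP/idP => [[[h hP] _ ->] /=|/leaves_formulas_with_leaves fP].
  by rewrite -(eqP hP) mem_formulas_with_leaves // (eqP hP) size_enum_ord.
by exists (Bracketing (introT eqP fP)); rewrite ?mem_enum.
Qed.

Lemma card_bracketing1 : #|{: bracketing 1}| = 1.
Proof. exact: (@card_bracketing _ 1 1 [:: tt]). Qed.

Lemma card_bracketing_rec (n : nat) : 2 <= n ->
  #|{: bracketing n}| =
  \sum_(1 <= i < n) #|{: bracketing i}| * #|{: bracketing (n - i)}|.
Proof.
(* Any list of length [n] will do, so the labels are taken in [unit]. *)
case: n => // k k_gt0; pose s := nseq k.+1 tt.
have size_s : size s = k.+1 by rewrite size_nseq.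
rewrite (card_bracketing size_s (leqnn _)).
rewrite size_formulas_with_leavesS size_s; last by case: k k_gt0 {s size_s}.
rewrite !big_nat; apply: eq_bigr => i /andP[i_gt0 i_le].
congr (_ * _); apply/esym/card_bracketing => //.
- by rewrite size_takel // size_s ltnW.
- by rewrite size_drop size_s.
(* The remaining fuel [k] is enough for the suffix because [1 <= i]. *)
- by rewrite leq_subLR -add1n leq_add2r.
Qed.

Lemma gE (n : nat) : g n = #|{: bracketing n}| * 3 ^ n.
Proof. by rewrite /g card_prod card_ffun !card_ord. Qed.

Theorem proposition1 :
  g 1 = 3 /\
  forall n : nat, 2 <= n -> g n = \sum_(1 <= i < n) g i * g (n - i).
Proof.
split=> [|n n_ge2]; first by rewrite gE card_bracketing1.
rewrite gE card_bracketing_rec // big_distrl /= !big_nat.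
(* Subtraction is truncated: [i + (n - i) = n] relies on [i <= n], given by the summation range. *)
apply: eq_bigr => i /andP[_ i_lt]; rewrite !gE mulnACA -expnD subnKC //.
exact: ltnW.
Qed.
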